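(* Let $\mathcal{H}$ be a complex Hilbert space and let $A\in\mathcal{B}(\mathcal{H})$. Then $$\frac14\|A^*A+AA^*\|\le\frac18\left[2\left(\|A+A^*\|^4+\|A-A^*\|^4\right)^2+8\|A+A^*\|^4\|A-A^*\|^4\right]^{1/4}\le w^2(A).$$
   Context: $\mathcal{B}(\mathcal{H})$ is the set of bounded linear operators on $\mathcal{H}$, $A^*$ is the adjoint of $A$, and $\|\cdot\|$ is the operator norm. The numerical radius is $w(A)=\sup\{|\langle Ax,x\rangle| : x\in\mathcal{H},\ \|x\|=1\}$, and $w^2(A)=(w(A))^2$. *)

(* Defs.v *)
From HB Require Import structures.
From mathcomp Require Import all_boot all_order all_algebra.
From mathcomp Require Import sesquilinear complex.
From mathcomp Require Import all_classical all_reals all_analysis.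

Set Implicit Arguments.
Unset Strict Implicit.
Unset Printing Implicit Defensive.

Import Order.TTheory GRing.Theory Num.Theory.
Import numFieldNormedType.Exports.

Local Open Scope classical_set_scope.
Local Open Scope ring_scope.
Local Open Scope complex_scope.

(* The inner product is linear in its first argument and conjugate-linear in
   the second one. *)
Record hilbertSpace (R : realType) := HilbertSpace {
  hilbert_sort :> completeNormedModType R[i] ;
  inner : {dot hilbert_sort for (@Num.conj R[i])} ;
  inner_normE : forall x : hilbert_sort, `|x| ^+ 2 = inner x x
}.

Section Operators.
Context {R : realType} {H : hilbertSpace R}.

Definition bounded_operator (A : H -> H) : Prop :=
  exists M : R, forall x : H, `|A x| <= M%:C * `|x|.

Definition is_adjoint (A B : H -> H) : Prop :=
  forall x y : H, inner H (A x) y = inner H x (B y).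

(* Uniqueness follows from definiteness of the inner product, and existence,
   for A linear and bounded, from the Riesz representation theorem; for other
   functions the value may be arbitrary. *)
Definition adjoint (A : H -> H) : H -> H := get [set B | is_adjoint A B].

(* Norms and moduli live in R[i]; since they are real, Re reads them in R. *)
Definition opnorm (A : H -> H) : R :=
  sup [set complex.Re `|A x| | x in [set x : H | `|x| <= 1]].

(* The supremum of the empty set is 0, so the radius is 0 when H is trivial. *)
Definition numerical_radius (A : H -> H) : R :=
  sup [set complex.Re `|inner H (A x) x| | x in [set x : H | `|x| = 1]].

End Operators.

(* Main.v *)
(* Write B for the adjoint of A, p = |A + B| and m = |A - B|. The bracket is
   (p^2 + m^2)^4 + (p^2 - m^2)^4. Discarding the second power and using
   (A + B)^2 - (A - B)^2 = 2 (BA + AB) gives the first inequality.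
   For the second one, the bracket increases with p and m, and both are at most
   2 w(A), because A + B and i(A - B) are selfadjoint and the norm of a
   selfadjoint operator is bounded by its numerical radius.
   The adjoint comes from the Riesz theorem, proved by minimizing
   <x, x> - 2 f(x). Only the real inner product Re <x, y> is used throughout;
   it determines the complex one since Im <x, y> = - Re <ix, y>. *)

Require Import Defs.
From HB Require Import structures.
From mathcomp Require Import all_boot all_order all_algebra.
From mathcomp Require Import sesquilinear complex ring lra.
From mathcomp Require Import all_classical all_reals all_analysis.

Set Implicit Arguments.
Unset Strict Implicit.
Unset Printing Implicit Defensive.

Import Order.TTheory GRing.Theory Num.Theory.
Import numFieldNormedType.Exports.

Local Open Scope classical_set_scope.
Local Open Scope ring_scope.

(** For an empty or unbounded set, [sup] takes its default value 0. *)
Lemma sup_nneg (R : realType) (S : set R) :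
  (forall s, S s -> 0 <= s) -> 0 <= sup S.
Proof.
move=> S0; have [[[s Ss] ubS]|/sup_out ->//] := pselect (has_sup S).
exact: le_trans (S0 _ Ss) (ub_le_sup ubS Ss).
Qed.

(** * The real inner product Re <x, y> and its norm *)

Section RealInner.
Local Open Scope complex_scope.
Context {R : realType} {H : hilbertSpace R}.
Implicit Types (x y z : H) (r : R).

Definition rinner x y : R := complex.Re (inner H x y).
Definition hnorm x : R := complex.Re `|x|.

Lemma ReZ (r : R) (z : R[i]) : complex.Re (r%:C * z) = r * complex.Re z.
Proof. by case: z => a b /=; rewrite mul0r subr0. Qed.

Lemma hnormE x : `|x| = (hnorm x)%:C.
Proof. by rewrite /hnorm RRe_real// ger0_real. Qed.

Lemma rinnerC x y : rinner x y = rinner y x.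
Proof.
rewrite /rinner hermC expr0 mul1r; apply: complexI.
by rewrite !complexRe Re_conj.
Qed.

Lemma rinnerDl x y z : rinner (x + y) z = rinner x z + rinner y z.
Proof. by rewrite /rinner linearDl raddfD. Qed.

Lemma rinnerZl r x y : rinner (r%:C *: x) y = r * rinner x y.
Proof. by rewrite /rinner linearZl_LR ReZ. Qed.

Lemma rinnerDr x y z : rinner x (y + z) = rinner x y + rinner x z.
Proof. by rewrite !(rinnerC x) rinnerDl. Qed.

Lemma rinnerZr r x y : rinner x (r%:C *: y) = r * rinner x y.
Proof. by rewrite !(rinnerC x) rinnerZl. Qed.

Lemma rinnerNl x y : rinner (- x) y = - rinner x y.
Proof. by rewrite /rinner linearNl raddfN. Qed.

Lemma rinnerNr x y : rinner x (- y) = - rinner x y.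
Proof. by rewrite !(rinnerC x) rinnerNl. Qed.

Definition rinnerE :=
  (rinnerDl, rinnerDr, rinnerNl, rinnerNr, rinnerZl, rinnerZr).

Lemma hnorm_ge0 x : 0 <= hnorm x.
Proof. by rewrite -(@ler0c R) -hnormE. Qed.

Lemma hnorm_sqr x : hnorm x ^+ 2 = rinner x x.
Proof. by rewrite /rinner -inner_normE hnormE -rmorphXn. Qed.

Lemma hnorm_eq0 x : (hnorm x == 0) = (x == 0).
Proof. by rewrite -[RHS]normr_eq0 hnormE -(inj_eq (@complexI R)). Qed.

Lemma hnormN x : hnorm (- x) = hnorm x.
Proof. by rewrite /hnorm normrN. Qed.

Lemma hnormZ r x : hnorm (r%:C *: x) = `|r| * hnorm x.
Proof.
by apply: complexI; rewrite -hnormE normrZ hnormE rmorphM normc_def/=;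
  rewrite expr0n addr0 sqrtr_sqr.
Qed.

Lemma hnormD x y : hnorm (x + y) <= hnorm x + hnorm y.
Proof. by rewrite -lecR rmorphD/= -!hnormE; exact: ler_normD. Qed.

Lemma Im_inner x y : complex.Im (inner H x y) = - rinner ('i *: x) y.
Proof.
by rewrite /rinner linearZl_LR/=; case: (inner H x y) => a b /=; 
   rewrite mul0r mul1r sub0r opprK.
Qed.

Lemma hnorm_i x : hnorm ('i *: x) = hnorm x.
Proof.
by rewrite /hnorm normrZ normc_def/= expr0n/= add0r expr1n sqrtr1 mul1r.
Qed.

(** Cauchy-Schwarz: expanding the square of the norm of |y| x - |x| y gives 2 |x| |y| (|x| |y| - <x,
    y>) >= 0, and the factor |x| |y| cancels unless a vector vanishes. *)
Lemma rinner_le x y : rinner x y <= hnorm x * hnorm y.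
Proof.
have := sqr_ge0 (hnorm ((hnorm y)%:C *: x - (hnorm x)%:C *: y)).
rewrite hnorm_sqr !rinnerE (rinnerC y x) -!hnorm_sqr => h.
have [/eqP|x0] := eqVneq (hnorm x) 0.
  rewrite hnorm_eq0 => /eqP->.
  by rewrite /rinner linear0l /hnorm normr0/= mul0r.
have [/eqP|y0] := eqVneq (hnorm y) 0.
  rewrite hnorm_eq0 => /eqP->.
  by rewrite rinnerC /rinner linear0l /hnorm normr0/= mulr0.
have xp : 0 < hnorm x * hnorm y by rewrite mulr_gt0// lt_def ?x0 ?y0 hnorm_ge0.
rewrite -(ler_pM2l xp); nra.
Qed.

Lemma normr_rinner_le x y : `|rinner x y| <= hnorm x * hnorm y.
Proof.
by rewrite ler_norml rinner_le andbT lerNl -rinnerNl -(hnormN x) rinner_le.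
Qed.

(** * Riesz representation of real-linear functionals *)

Lemma posc_real (e : R[i]) : 0 < e -> exists2 r : R, 0 < r & e = r%:C.
Proof.
by move=> e0; exists (complex.Re e); rewrite -?ltcR RRe_real ?gtr0_real.
Qed.

(** The functional [J] is bounded below because |x|^2 - 2 M |x| >= - M^2. Its near-minimizers form a
    Cauchy filter; the limit z minimizes [J], and the vanishing of the first variation there says
    that z represents [f]. *)
Lemma real_riesz (f : H -> R) (M : R) :
  {morph f : x y / x + y} -> (forall r x, f (r%:C *: x) = r * f x) ->
  (forall x, f x <= M * hnorm x) ->
  exists z, forall x, f x = rinner x z.
Proof.
move=> fD fZ fM.
have fN x : f (- x) = - f x.
  by rewrite -[- x]scaleN1r -(rmorphN1 (real_complex R)) fZ mulN1r.
pose J x := rinner x x - 2 * f x.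
have Jlb x : - M ^+ 2 <= J x.
  rewrite /J -hnorm_sqr; have := fM x; have := sqr_ge0 (hnorm x - M); nra.
have hinf : has_inf (range J).
  split; first by exists (J 0), 0.
  by exists (- M ^+ 2) => _ [x _ <-].
pose d := inf (range J).
have dJ x : d <= J x by apply: ge_inf; [case: hinf | exists x].
pose S (e : R) := [set x | J x < d + e].
have S0 e : 0 < e -> S e !=set0.
  by move=> e0; have [_ [x _ <-] xe] := inf_adherent e0 hinf; exists x.
have mid x y : hnorm (x - y) ^+ 2 <= 2 * J x + 2 * J y - 4 * d.
  (* the parallelogram identity applied to the midpoint of x and y *)
  have := dJ ((2^-1)%:C *: (x + y)).
  rewrite hnorm_sqr /J fZ fD !rinnerE (rinnerC y x); lra.
(* This filter of near-minimizers replaces a minimizing sequence. *)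
pose F := filter_from [set e : R | 0 < e] S.
have FF : ProperFilter F.
  apply: filter_from_proper; last by move=> e /S0.
  apply: filter_from_filter; first by exists 1 => /=.
  move=> e1 e2 /= e1p e2p; exists (Num.min e1 e2) => /=.
    by rewrite lt_min e1p.
  by move=> x; rewrite /S/= -ltrBlDl lt_min !ltrBlDl => /andP.
have : cvg F.
  apply: cauchy_cvg; apply: cauchy_exP => e /posc_real[r r0 ->].
  (* If [J x] and [J y] are below d + e, then [mid] gives |x - y|^2 < 4 e; hence e = r^2 / 4. *)
  have r20 : 0 < r ^+ 2 / 4 by rewrite divr_gt0// exprn_gt0.
  have [x xS] := S0 _ r20.
  exists x, (r ^+ 2 / 4) => //= y yS.
  rewrite -ball_normE/= hnormE ltcR -(ltr_pXn2r (_ : (0 < 2)%N))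
    ?nnegrE ?hnorm_ge0 ?ltW//.
  have := mid x y; rewrite /S/= in xS yS; lra.
move=> /cvg_ex[z Fz]; exists z.
have Jz : J z <= d.
  (* With u = z - x, J z - J x = 2 <z, u> - |u|^2 - 2 f u <= 2 (|z| + |M|) |u|. If |u| and J x - d
     are both below e / C, then J z - d is below e. *)
  pose C := 1 + 2 * hnorm z + 2 * `|M|.
  have C1 : 1 <= C.
    by have := hnorm_ge0 z; have := normr_ge0 M; rewrite /C; lra.
  apply/ler_addgt0Pl => e e0.
  have eC : 0 < e / C by rewrite divr_gt0//; lra.
  have /fcvg_ballP/(_ (e / C)%:C) := Fz.
  rewrite ltcR => /(_ eC)[e' e'0 zS].
  pose e2 := Num.min e' (e / C).
  have [|x xS] := S0 e2; first by rewrite lt_min e'0.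
  have /zS : S e' x.
    by rewrite /S/= (lt_le_trans xS)// lerD2l ge_min lexx.
  rewrite -ball_normE/= hnormE ltcR => zx.
  have xe : J x < d + e / C.
    by rewrite (lt_le_trans xS)// lerD2l ge_min lexx orbT.
  have eE : e = C * (e / C) by rewrite mulrC divfK// gt_eqF; lra.
  have h1 := rinner_le z (z - x).
  have h2 : - f (z - x) <= `|M| * hnorm (z - x).
    by rewrite -fN -hnormN (le_trans (fM _))// ler_wpM2r ?hnorm_ge0 ?ler_norm.
  have h3 := sqr_ge0 (hnorm (z - x)).
  have h4 := ler_wpM2l (hnorm_ge0 z) (ltW zx).
  have h5 := ler_wpM2l (normr_ge0 M) (ltW zx).
  rewrite {}eE /C; rewrite hnorm_sqr in h3.
  move: xe h1 h2 h3 h4 h5; rewrite /J fD fN !rinnerE (rinnerC x z); lra.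
(* a positive value would make J decrease from z in the direction of x *)
have key x : f x - rinner x z <= 0.
  pose b := f x - rinner x z.
  rewrite leNgt; apply/negP => b0.
  (* J (z + t x) - J z = t^2 |x|^2 - 2 t b, which for this t equals - t^2 (2 + |x|^2) < 0. The
     summand 1 keeps the denominator positive. *)
  pose t := b / (1 + rinner x x).
  have c0 : 0 <= rinner x x by rewrite -hnorm_sqr sqr_ge0.
  have tE : b = t * (1 + rinner x x) by rewrite divfK// gt_eqF; lra.
  have t0 : 0 < t by rewrite divr_gt0//; lra.
  have := le_trans Jz (dJ (z + t%:C *: x)).
  rewrite /J fD fZ !rinnerE (rinnerC z x).
  rewrite /b in tE; nra.
move=> x; have := key x; have := key (- x); rewrite fN rinnerE; lra.
Qed.

(** * Multiplication by ['i] and the return to the complex inner product *)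

Lemma rinner_ii x y : rinner ('i *: x) ('i *: y) = rinner x y.
Proof.
have ii u : rinner ('i *: u) ('i *: u) = rinner u u.
  by rewrite -!hnorm_sqr hnorm_i.
(* Polarization: the squares cancel by [ii] at x and at y, leaving the cross terms. *)
have := ii (x + y); rewrite scalerDr !rinnerE !ii.
rewrite (rinnerC y) (rinnerC ('i *: y)); lra.
Qed.

Lemma rinner_ir x y : rinner x ('i *: y) = - rinner ('i *: x) y.
Proof.
by rewrite -(rinner_ii _ y) scalerA -expr2 sqr_i scaleN1r rinnerNl opprK.
Qed.

Lemma rinner_inj x y : (forall z, rinner z x = rinner z y) -> x = y.
Proof.
move=> xy; apply/eqP; rewrite -subr_eq0 -hnorm_eq0 -sqrf_eq0 hnorm_sqr.
by rewrite rinnerDr rinnerNr xy subrr.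
Qed.

Lemma rinner_inner (u v x y : H) : rinner u v = rinner x y ->
  rinner ('i *: u) v = rinner ('i *: x) y -> inner H u v = inner H x y.
Proof.
move=> uv iuv; apply/eqP; rewrite eq_complex !Im_inner iuv eqxx andbT.
exact/eqP.
Qed.

Lemma normr_rinner_inner x y : `|rinner x y| <= complex.Re `|inner H x y|.
Proof. by have := normc_ge_Re (inner H x y); rewrite lecE => /andP[]. Qed.

Lemma normr_rinner_i x y : `|rinner ('i *: x) y| <= complex.Re `|inner H x y|.
Proof.
rewrite (le_trans (normr_rinner_inner _ _))// linearZl_LR normrM.
by rewrite [`|'i|]normc_def expr0n add0r expr1n sqrtr1 mul1r.
Qed.

(* The factor 2 is not optimal, but only boundedness matters. *)
Lemma norm_inner_le x y :
  complex.Re `|inner H x y| <= 2 * (hnorm x * hnorm y).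
Proof.
have := normr_rinner_le x y.
have := normr_rinner_le ('i *: x) y; rewrite hnorm_i -normrN -Im_inner.
rewrite /rinner normc_def/=; case: (inner H x y) => a b /= h1 h2.
have : Num.sqrt (a ^+ 2 + b ^+ 2) <= `|a| + `|b|.
  apply: (@le_trans _ _ (Num.sqrt ((`|a| + `|b|) ^+ 2))); last first.
    by rewrite sqrtr_sqr ger0_norm ?addr_ge0.
  rewrite ler_wsqrtr// sqrrD.
  by rewrite !real_normK ?num_real// addrAC lerDl mulrn_wge0// mulr_ge0.
lra.
Qed.

(** * The norm of a selfadjoint operator is controlled by its quadratic form *)

Section SelfAdjoint.
Context (T : H -> H) (c : R).
Context (TD : {morph T : x y / x + y}).
Context (TZ : forall r x, T (r%:C *: x) = r%:C *: T x).
Context (Tsym : forall x y, rinner (T x) y = rinner x (T y)).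
Context (Tc : forall x, `|rinner (T x) x| <= c * hnorm x ^+ 2).

Lemma selfadjoint_norm_le x : hnorm (T x) <= c * hnorm x.
Proof.
have [->|x0] := eqVneq x 0.
  have := TZ 0 0; rewrite !scale0r => ->.
  by rewrite /hnorm normr0 mulr0.
have Nx : 0 < hnorm x by rewrite lt_def hnorm_eq0 x0 hnorm_ge0.
have [->|Tx0] := eqVneq (T x) 0.
  (* The sign of [c] is read off from [Tc] at the nonzero vector x. *)
  have := le_trans (normr_ge0 _) (Tc x); rewrite pmulr_lge0 ?exprn_gt0//.
  by rewrite /hnorm normr0 => c0; rewrite mulr_ge0// -/(hnorm x) ltW.
have NT : 0 < hnorm (T x) by rewrite lt_def hnorm_eq0 Tx0 hnorm_ge0.
pose k := hnorm x / hnorm (T x).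
have k0 : 0 < k by rewrite divr_gt0.
have kE : hnorm x = k * hnorm (T x) by rewrite divfK// gt_eqF.
(* With y = (|x| / |Tx|) Tx, of the same norm as x, polarization gives
   4 |x| |Tx| = <T(x+y), x+y> - <T(x-y), x-y> <= 2 c (|x|^2 + |y|^2). *)
have [y yE] : exists y, y = k%:C *: T x by exists (k%:C *: T x).
have /ler_normlP[_ h1] := Tc (x + y).
have /ler_normlP[h2 _] := Tc (x - y).
have TN : T (- y) = - T y.
  by rewrite -scaleN1r -(rmorphN1 (real_complex R)) TZ rmorphN1 scaleN1r.
move: h1 h2; rewrite !hnorm_sqr !TD TN !rinnerE (Tsym y x).
rewrite (rinnerC (T x) y) (rinnerC y x).
have -> : rinner y (T x) = hnorm x * hnorm (T x).
  by rewrite yE rinnerE -hnorm_sqr kE; ring.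
have -> : rinner y y = hnorm x ^+ 2.
  by rewrite yE !rinnerE -hnorm_sqr kE; ring.
rewrite -hnorm_sqr => h1 h2.
rewrite -(ler_pM2l Nx); lra.
Qed.

End SelfAdjoint.

(** * Bounds through the operator norm and the numerical radius *)

Lemma opnorm_le (T : H -> H) (c : R) :
  (forall x, hnorm x <= 1 -> hnorm (T x) <= c) -> opnorm T <= c.
Proof.
move=> Tc; apply: ge_sup.
  by exists (hnorm (T 0)), 0 => //=; rewrite normr0 ler01.
by move=> _ [x /= x1 <-]; apply: Tc; rewrite -lecR -hnormE.
Qed.

(** The bound [M] makes the supremum in [opnorm] finite, so that it dominates the value at x /
    |x|. *)
Lemma hnorm_le_opnorm (T : H -> H) (M : R) x :
  (forall r x, T (r%:C *: x) = r%:C *: T x) ->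
  (forall x, hnorm (T x) <= M * hnorm x) ->
  hnorm (T x) <= opnorm T * hnorm x.
Proof.
move=> TZ TM.
have [x0|x0] := eqVneq (hnorm x) 0.
  by have := TM x; rewrite x0 !mulr0.
have Nx : 0 < hnorm x by rewrite lt_def x0 hnorm_ge0.
rewrite -ler_pdivrMr// mulrC.
have -> : (hnorm x)^-1 * hnorm (T x) = hnorm (T ((hnorm x)^-1%:C *: x)).
  by rewrite TZ hnormZ ger0_norm// invr_ge0 ltW.
apply: ub_le_sup; last first.
  exists ((hnorm x)^-1%:C *: x) => //=.
  by rewrite hnormE hnormZ ger0_norm ?mulVf ?lexx ?invr_ge0 ?hnorm_ge0.
exists `|M| => _ [u /= u1 <-]; rewrite -/(hnorm _).
rewrite (le_trans (TM u))//.
move: u1; rewrite hnormE lecR => u1.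
rewrite (@le_trans _ _ (`|M| * hnorm u))//.
  by rewrite ler_wpM2r ?hnorm_ge0 ?ler_norm.
by rewrite ler_piMr.
Qed.

Lemma numerical_radius_ge0 (A : H -> H) : 0 <= numerical_radius A.
Proof.
apply: sup_nneg => _ [x _ <-].
by rewrite (le_trans _ (normr_rinner_inner _ _)).
Qed.

Lemma opnorm_ge0 (T : H -> H) : 0 <= opnorm T.
Proof. by apply: sup_nneg => _ [x _ <-]; exact: hnorm_ge0. Qed.

(** The form <A x, x> scales by k^2 when x scales by a real k, which reduces to unit vectors;
    boundedness of [A] makes the supremum finite. *)
Lemma norm_inner_le_radius (A : {linear H -> H}) x : bounded_operator A ->
  complex.Re `|inner H (A x) x| <= numerical_radius A * hnorm x ^+ 2.
Proof.
move=> [M AM].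
have {}AM u : hnorm (A u) <= M * hnorm u.
  by have := AM u; rewrite !hnormE -rmorphM lecR.
have [->|x0] := eqVneq x 0.
  by rewrite !linear0 ?linear0l /hnorm !normr0 expr0n/= mulr0.
have Nx : 0 < hnorm x by rewrite lt_def hnorm_eq0 x0 hnorm_ge0.
rewrite -ler_pdivrMr ?exprn_gt0//.
pose k := (hnorm x)^-1.
have k0 : 0 < k by rewrite invr_gt0.
apply: ub_le_sup; last first.
  exists (k%:C *: x).
    by rewrite /= hnormE hnormZ (ger0_norm (ltW k0)) mulVf ?gt_eqF.
  have -> : A (k%:C *: x) = k%:C *: A x by rewrite linearZ.
  have kC : `|k%:C| = k%:C by rewrite ger0_norm// ler0c ltW.
  rewrite linearZl_LR linearZr_LR [X in _ * X]mulrC !normrM norm_conjC kC mulrC.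
  rewrite -mulrA -rmorphM mulrC ReZ mulrC /k; congr (_ * _); field.
  by rewrite gt_eqF.
exists (2 * `|M|) => _ [u /= u1 <-].
rewrite (le_trans (norm_inner_le _ _))//.
have {}u1 : hnorm u = 1 by rewrite /hnorm u1.
have := AM u; rewrite u1 !mulr1; have := ler_norm M; lra.
Qed.

(** * Existence, real-linearity and boundedness of the adjoint *)

Lemma adjointP (A : {linear H -> H}) :
  bounded_operator A -> is_adjoint A (adjoint A).
Proof.
move=> [M AM].
have {}AM u : hnorm (A u) <= M * hnorm u.
  by have := AM u; rewrite !hnormE -rmorphM lecR.
have /choice[B BP] : forall y, exists z, forall x, rinner (A x) y = rinner x z.
  move=> y; apply: (@real_riesz (fun x => rinner (A x) y) (M * hnorm y)).
  - by move=> u v; rewrite linearD rinnerDl.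
  - by move=> r u; rewrite linearZ rinnerZl.
  - move=> u; rewrite (le_trans (rinner_le _ _))// mulrAC.
    by rewrite ler_wpM2r ?hnorm_ge0.
(* The real identity at ['i *: x] supplies the imaginary part, since [A] commutes with ['i]. *)
have : is_adjoint A B.
  by move=> x y; apply: rinner_inner; rewrite -?linearZ.
exact: getI.
Qed.

Section AdjointOperator.
Context (A : {linear H -> H}) (bA : bounded_operator A).
Local Notation As := (adjoint A).

Lemma rinner_adj x y : rinner (A x) y = rinner x (As y).
Proof. by rewrite /rinner (adjointP bA). Qed.

Lemma adjointD : {morph As : x y / x + y}.
Proof.
by move=> x y; apply: rinner_inj => z; rewrite rinnerDr -!rinner_adj rinnerDr.
Qed.

Lemma adjointB : {morph As : x y / x - y}.
Proof.
move=> x y; apply: rinner_inj => z.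
by rewrite rinnerDr rinnerNr -!rinner_adj rinnerDr rinnerNr.
Qed.

Lemma adjointZ r x : As (r%:C *: x) = r%:C *: As x.
Proof.
by apply: rinner_inj => z; rewrite rinnerZr -!rinner_adj rinnerZr.
Qed.

(** For the adjoint, |A* x|^2 = <A A* x, x> <= M |A* x| |x|; divide by |A* x|. *)
Lemma adjoint_bounded :
  exists M, forall x, hnorm (A x) <= M * hnorm x /\ hnorm (As x) <= M * hnorm x.
Proof.
case: bA => M AM; exists M => x.
have {}AM u : hnorm (A u) <= M * hnorm u.
  by have := AM u; rewrite !hnormE -rmorphM lecR.
split=> //.
have [Ax0|Ax0] := eqVneq (hnorm (As x)) 0.
  by rewrite Ax0 (le_trans _ (AM x))// hnorm_ge0.
have Nx : 0 < hnorm (As x) by rewrite lt_def Ax0 hnorm_ge0.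
rewrite -(ler_pM2l Nx) -expr2 hnorm_sqr -rinner_adj.
rewrite (le_trans (rinner_le _ _))// mulrCA mulrA.
by rewrite ler_wpM2r ?hnorm_ge0.
Qed.

(** * Norms of A + A*, A - A* and A*A + AA* *)

Lemma hnorm_addA_le x : hnorm (A x + As x) <= opnorm (A \+ As) * hnorm x.
Proof.
have [M AM] := adjoint_bounded.
apply: (@hnorm_le_opnorm (A \+ As) (2 * M)) => [r u|u] /=.
  by rewrite linearZ adjointZ scalerDr.
have [h1 h2] := AM u; rewrite (le_trans (hnormD _ _))//; lra.
Qed.

Lemma hnorm_subA_le x : hnorm (A x - As x) <= opnorm (A \- As) * hnorm x.
Proof.
have [M AM] := adjoint_bounded.
apply: (@hnorm_le_opnorm (A \- As) (2 * M)) => [r u|u] /=.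
  by rewrite linearZ adjointZ scalerBr.
have [h1 h2] := AM u; rewrite (le_trans (hnormD _ _))// hnormN; lra.
Qed.

Lemma opnorm_addA_le_radius : opnorm (A \+ As) <= 2 * numerical_radius A.
Proof.
have w0 := numerical_radius_ge0 A; set w := numerical_radius A in w0 *.
have key x : hnorm (A x + As x) <= 2 * w * hnorm x.
  apply: (@selfadjoint_norm_le (fun x => A x + As x)) => {x}.
  - by move=> x y; rewrite linearD adjointD addrACA.
  - by move=> r x; rewrite linearZ adjointZ scalerDr.
  - move=> x y; rewrite rinnerDl rinnerDr (rinnerC (As x)) -!rinner_adj.
    by rewrite addrC rinnerC.
  - move=> x; rewrite rinnerDl (rinnerC (As x)) -rinner_adj.
    have := le_trans (normr_rinner_inner _ _) (norm_inner_le_radius x bA).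
    rewrite -/w !ler_norml; lra.
apply: opnorm_le => x x1 /=; rewrite (le_trans (key x))// ler_piMr//; lra.
Qed.

Lemma opnorm_subA_le_radius : opnorm (A \- As) <= 2 * numerical_radius A.
Proof.
have w0 := numerical_radius_ge0 A; set w := numerical_radius A in w0 *.
have key x : hnorm (A x - As x) <= 2 * w * hnorm x.
  have idiff u v : rinner ('i *: (A u - As u)) v =
      rinner ('i *: A u) v + rinner ('i *: A v) u.
    rewrite scalerBr rinnerDl rinnerNl -rinner_ir (rinnerC (As u)) -rinner_adj.
    by rewrite linearZ.
  rewrite -hnorm_i.
  apply: (@selfadjoint_norm_le (fun x => 'i *: (A x - As x))) => {x}.
  - by move=> x y; rewrite -scalerDr (linearD A) adjointD opprD addrACA.
  - by move=> r x; rewrite linearZ adjointZ -scalerBr !scalerA mulrC.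
  - by move=> x y; rewrite [RHS]rinnerC !idiff addrC.
  - move=> x; rewrite idiff.
    have := le_trans (normr_rinner_i _ _) (norm_inner_le_radius x bA).
    rewrite -/w !ler_norml; lra.
apply: opnorm_le => x x1 /=; rewrite (le_trans (key x))// ler_piMr//; lra.
Qed.

Lemma opnorm_anticommutator_le :
  opnorm ((As \o A) \+ (A \o As)) <=
    2^-1 * (opnorm (A \+ As) ^+ 2 + opnorm (A \- As) ^+ 2).
Proof.
have p0 : 0 <= opnorm (A \+ As) := opnorm_ge0 _.
have m0 : 0 <= opnorm (A \- As) := opnorm_ge0 _.
apply: opnorm_le => x x1 /=.
have -> : As (A x) + A (As x) = 2^-1%:C *: ((A (A x + As x) + As (A x + As x))
    - (A (A x - As x) - As (A x - As x))).
  rewrite (linearB A) (linearD A) adjointB adjointD opprB.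
  rewrite [_ - _ - _]addrC opprB addrACA [A (A x) + _]addrC.
  rewrite (addrACA (A _)) (addrACA (adjoint A (A x))) !subrr !addr0.
  rewrite -!mulr2n -mulrnDl -[(_ + _) *+ 2]scaler_nat scalerA addrC.
  by rewrite -(rmorph_nat (real_complex R)) -rmorphM mulVf ?pnatr_eq0// scale1r.
rewrite hnormZ ger0_norm ?invr_ge0// ler_pM2l ?invr_gt0//.
rewrite (le_trans (hnormD _ _))// hnormN lerD//.
  rewrite (le_trans (hnorm_addA_le _))// expr2 ler_wpM2l//.
  by rewrite (le_trans (hnorm_addA_le _))// ler_piMr.
rewrite (le_trans (hnorm_subA_le _))// expr2 ler_wpM2l//.
by rewrite (le_trans (hnorm_subA_le _))// ler_piMr.
Qed.

End AdjointOperator.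
End RealInner.

(** * The scalar inequalities and the conclusion *)

Lemma middle_bounds (R : realType) (p m w : R) :
  0 <= p <= 2 * w -> 0 <= m <= 2 * w ->
  let middle :=
    8^-1 * (2 * (p ^+ 4 + m ^+ 4) ^+ 2 + 8 * p ^+ 4 * m ^+ 4) `^ (4^-1) in
  8^-1 * (p ^+ 2 + m ^+ 2) <= middle /\ middle <= w ^+ 2.
Proof.
move=> /andP[p0 pw] /andP[m0 mw] /=; set X := 2 * _ + _.
have root4 (x : R) : 0 <= x -> (x ^+ 4) `^ 4^-1 = x.
  by move=> x0; rewrite -powR_mulrn// -powRrM divff ?powRr1// pnatr_eq0.
have XE : X = (p ^+ 2 + m ^+ 2) ^+ 4 + (p ^+ 2 - m ^+ 2) ^+ 4.
  by rewrite /X; ring.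
have X0 : 0 <= X by rewrite XE addr_ge0 ?exprn_even_ge0.
have w0 : 0 <= w by lra.
split.
  rewrite ler_pM2l ?invr_gt0// -[leLHS]root4 ?addr_ge0 ?sqr_ge0//.
  apply: ge0_ler_powR; rewrite ?nnegrE ?invr_ge0 ?exprn_even_ge0//.
  by rewrite XE lerDl exprn_even_ge0.
have wE : w ^+ 2 = 8^-1 * (8 * w ^+ 2) by field.
rewrite wE ler_pM2l ?invr_gt0// -[leRHS]root4 ?mulr_ge0 ?sqr_ge0//.
apply: ge0_ler_powR; rewrite ?nnegrE ?invr_ge0 ?exprn_even_ge0//.
have p4 : p ^+ 4 <= (2 * w) ^+ 4 by rewrite lerXn2r ?nnegrE ?mulr_ge0.
have m4 : m ^+ 4 <= (2 * w) ^+ 4 by rewrite lerXn2r ?nnegrE ?mulr_ge0.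
(* With W = (2 w)^4 in place of both p^4 and m^4, the bracket becomes 2 (2 W)^2 + 8 W^2 = 16 W^2. *)
rewrite /X; have -> : (8 * w ^+ 2) ^+ 4 = 16 * ((2 * w) ^+ 4) ^+ 2 by ring.
move: p4 m4 (exprn_ge0 4 p0) (exprn_ge0 4 m0).
move: (p ^+ 4) (m ^+ 4) ((2 * w) ^+ 4) => P Q W PW QW P0 Q0; nra.
Qed.

Theorem theorem2p16 (R : realType) (H : hilbertSpace R)
    (A : {linear H -> H}) (hA : bounded_operator A) :
  let As := adjoint A in
  let p := opnorm (A \+ As) in
  let m := opnorm (A \- As) in
  let middle :=
    8^-1 * (2 * (p ^+ 4 + m ^+ 4) ^+ 2 + 8 * p ^+ 4 * m ^+ 4) `^ (4^-1) in
  4^-1 * opnorm ((As \o A) \+ (A \o As)) <= middle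
  /\ middle <= numerical_radius A ^+ 2.
Proof.
move=> As p m middle.
have p0 : 0 <= p := opnorm_ge0 _.
have m0 : 0 <= m := opnorm_ge0 _.
have [|| lb ub] := @middle_bounds _ p m (numerical_radius A).
- by rewrite p0 opnorm_addA_le_radius.
- by rewrite m0 opnorm_subA_le_radius.
split=> //; apply: le_trans lb.
have := opnorm_anticommutator_le hA; rewrite -/As -/p -/m; lra.
Qed.
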